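(* Let $(\mathscr{K},\otimes,1)$ be a tensor triangulated category and let $f:a\to b$ be a morphism in $\mathscr{K}$. Suppose that $f$ vanishes in $\mathscr{K}/\mathscr{P}$ for all $\mathscr{P}\in\operatorname{Spc}(\mathscr{K})$. Then there exists an integer $n\geq1$ such that $f^{\otimes n}=0$.
   Context: All categories are essentially small. A tensor triangulated category $(\mathscr{K},\otimes,1)$ is a triangulated category $\mathscr{K}$ (translation functor $T$) with a symmetric monoidal product $\otimes:\mathscr{K}\times\mathscr{K}\to\mathscr{K}$ which is exact in each variable, with unit $1$. A thick $\otimes$-ideal of $\mathscr{K}$ is a full subcategory $\mathscr{A}$ containing $0$ such that: (a) for any distinguished triangle $a\to b\to c\to Ta$, if two of $a,b,c$ belong to $\mathscr{A}$ then so does the third; (b) if $a\in\mathscr{A}$ and $a\simeq b\oplus c$ in $\mathscr{K}$ then $b,c\in\mathscr{A}$; (c) if $a\in\mathscr{A}$ and $b\in\mathscr{K}$ then $a\otimes b\in\mathscr{A}$. A prime of $\mathscr{K}$ is a thick $\otimes$-ideal $\mathscr{P}\subsetneq\mathscr{K}$ such that $a\otimes b\in\mathscr{P}$ implies $a\in\mathscr{P}$ or $b\in\mathscr{P}$. $\operatorname{Spc}(\mathscr{K})$ is the set of all primes of $\mathscr{K}$. $\mathscr{K}/\mathscr{P}$ is the Verdier quotient (localization of $\mathscr{K}$ at the morphisms whose cone lies in $\mathscr{P}$). $f^{\otimes n}$ denotes the $n$-fold product $f\otimes\cdots\otimes f:a^{\otimes n}\to b^{\otimes n}$. *)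

(* Defs.v *)
From HB Require Import structures.
From mathcomp Require Import all_boot all_algebra generic_quotient.
From mathcomp Require Import boolp classical_sets.

Set Implicit Arguments.
Unset Strict Implicit.
Unset Printing Implicit Defensive.

Import GRing.Theory.

Local Obligation Tactic := try by [].

Declare Scope cat_scope.
Delimit Scope cat_scope with cat.
Local Open Scope classical_set_scope.
Local Open Scope ring_scope.
Local Open Scope cat_scope.

Reserved Notation "a ~> b" (at level 70, no associativity).
Reserved Notation "g ∘ f" (at level 40, left associativity).
Reserved Notation "a ≅ b" (at level 70, no associativity).
Reserved Notation "a ⊕ b" (at level 50, left associativity).
Reserved Notation "a ⊗ b" (at level 40, left associativity).
Reserved Notation "f ⊗₁ g" (at level 40, left associativity).

Record category := Category {
  obj :> Type;
  hom : obj -> obj -> Type;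
  idm : forall a, hom a a;
  compm : forall a b c, hom b c -> hom a b -> hom a c;
  compm_idl : forall a b (f : hom a b), compm (idm b) f = f;
  compm_idr : forall a b (f : hom a b), compm f (idm a) = f;
  compmA : forall a b c d (h : hom c d) (g : hom b c) (f : hom a b),
    compm h (compm g f) = compm (compm h g) f }.

Arguments hom {_}.
Arguments idm {_}.
Arguments compm {_ _ _ _}.
Notation "a ~> b" := (hom a b) : cat_scope.
Notation "g ∘ f" := (compm g f) : cat_scope.

Definition is_iso (C : category) (a b : C) (f : a ~> b) : Prop :=
  exists g : b ~> a, g ∘ f = idm a /\ f ∘ g = idm b.

Definition isomorphic (C : category) (a b : C) : Prop :=
  exists f : a ~> b, is_iso f.
Notation "a ≅ b" := (isomorphic a b) : cat_scope.

Definition is_zero_object (C : category) (z : C) : Prop :=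
  forall a : C, (exists! f : a ~> z, True) /\ (exists! f : z ~> a, True).

(* The zero morphism [a ~> b] of a category with a zero object [z] is the
   composite [a ~> z ~> b]; it does not depend on [z]. *)
Definition is_zero_mor (C : category) (a b : C) (f : a ~> b) : Prop :=
  exists (z : C) (g : a ~> z) (h : z ~> b), is_zero_object z /\ f = h ∘ g.

Record functor (C D : category) := Functor {
  fobj :> C -> D;
  fmor : forall a b : C, a ~> b -> fobj a ~> fobj b;
  fmor_id : forall a, fmor (idm a) = idm (fobj a);
  fmor_comp : forall (a b c : C) (g : b ~> c) (f : a ~> b),
    fmor (g ∘ f) = fmor g ∘ fmor f }.

Arguments fmor {_ _} _ {_ _}.

Program Definition id_functor (C : category) : functor C C :=
  @Functor C C id (fun a b f => f) _ _.

Program Definition comp_functor (C D E : category)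
    (G : functor D E) (F : functor C D) : functor C E :=
  @Functor C E (fun a => G (F a)) (fun a b f => fmor G (fmor F f)) _ _.
Next Obligation. by move=> C D E G F a; rewrite /= !fmor_id. Qed.
Next Obligation. by move=> C D E G F a b c g f; rewrite /= !fmor_comp. Qed.

Definition is_natural_iso (C D : category) (F G : functor C D)
    (eta : forall a : C, F a ~> G a) : Prop :=
  (forall a, is_iso (eta a)) /\
  (forall (a b : C) (f : a ~> b), eta b ∘ fmor F f = fmor G f ∘ eta a).

Definition naturally_iso (C D : category) (F G : functor C D) : Prop :=
  exists eta : forall a : C, F a ~> G a, is_natural_iso eta.

Definition is_equivalence (C D : category) (F : functor C D) : Prop :=
  exists G : functor D C,
    naturally_iso (comp_functor G F) (id_functor C) /\
    naturally_iso (comp_functor F G) (id_functor D).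

Record additiveCategory := AdditiveCategory {
  add_cat :> category;
  hom_zmod : forall a b : add_cat, GRing.Zmodule (a ~> b);
  compm_addl : forall (a b c : add_cat) (g g' : b ~> c) (f : a ~> b),
    ((g : GRing.Zmodule.Pack (hom_zmod b c)) + g') ∘ f
      = (g ∘ f : GRing.Zmodule.Pack (hom_zmod a c)) + g' ∘ f;
  compm_addr : forall (a b c : add_cat) (g : b ~> c) (f f' : a ~> b),
    g ∘ ((f : GRing.Zmodule.Pack (hom_zmod a b)) + f')
      = (g ∘ f : GRing.Zmodule.Pack (hom_zmod a c)) + g ∘ f';
  zero_obj : add_cat;
  zero_objP : is_zero_object zero_obj;
  dsum : add_cat -> add_cat -> add_cat;
  inj1 : forall a b, a ~> dsum a b;
  inj2 : forall a b, b ~> dsum a b;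
  prj1 : forall a b, dsum a b ~> a;
  prj2 : forall a b, dsum a b ~> b;
  prj1_inj1 : forall a b, prj1 a b ∘ inj1 a b = idm a;
  prj2_inj2 : forall a b, prj2 a b ∘ inj2 a b = idm b;
  prj1_inj2 : forall a b,
    prj1 a b ∘ inj2 a b = (0 : GRing.Zmodule.Pack (hom_zmod b a));
  prj2_inj1 : forall a b,
    prj2 a b ∘ inj1 a b = (0 : GRing.Zmodule.Pack (hom_zmod a b));
  inj_prj : forall a b,
    (inj1 a b ∘ prj1 a b
      : GRing.Zmodule.Pack (hom_zmod (dsum a b) (dsum a b)))
    + inj2 a b ∘ prj2 a b = idm (dsum a b) }.

HB.instance Definition _ (A : additiveCategory) (a b : A) :
  GRing.Zmodule (a ~> b) := hom_zmod a b.

Notation "a ⊕ b" := (dsum a b) : cat_scope.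

Definition is_additive (A B : additiveCategory) (F : functor A B) : Prop :=
  forall (a b : A) (f g : a ~> b), fmor F (f + g) = fmor F f + fmor F g.

Record triangulatedCategory := TriangulatedCategory {
  tri_add :> additiveCategory;
  shift : functor tri_add tri_add;
  shift_equiv : is_equivalence shift;
  shift_additive : is_additive shift;
  dist : forall a b c : tri_add,
    a ~> b -> b ~> c -> c ~> shift a -> Prop;
  dist_iso : forall (a b c a' b' c' : tri_add)
      (f : a ~> b) (g : b ~> c) (h : c ~> shift a)
      (f' : a' ~> b') (g' : b' ~> c') (h' : c' ~> shift a')
      (u : a ~> a') (v : b ~> b') (w : c ~> c'),
    is_iso u -> is_iso v -> is_iso w ->
    v ∘ f = f' ∘ u -> w ∘ g = g' ∘ v -> fmor shift u ∘ h = h' ∘ w ->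
    dist f g h -> dist f' g' h';
  dist_id : forall a : tri_add,
    dist (idm a) (0 : a ~> zero_obj tri_add) (0 : zero_obj tri_add ~> shift a);
  dist_complete : forall (a b : tri_add) (f : a ~> b),
    exists (c : tri_add) (g : b ~> c) (h : c ~> shift a), dist f g h;
  dist_rotate : forall (a b c : tri_add)
      (f : a ~> b) (g : b ~> c) (h : c ~> shift a),
    dist f g h <-> dist g h (- fmor shift f);
  dist_mor : forall (a b c a' b' c' : tri_add)
      (f : a ~> b) (g : b ~> c) (h : c ~> shift a)
      (f' : a' ~> b') (g' : b' ~> c') (h' : c' ~> shift a')
      (u : a ~> a') (v : b ~> b'),
    dist f g h -> dist f' g' h' -> v ∘ f = f' ∘ u ->
    exists w : c ~> c', w ∘ g = g' ∘ v /\ fmor shift u ∘ h = h' ∘ w;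
  dist_octahedron : forall (a b c a' b' c' : tri_add)
      (f : a ~> b) (f1 : b ~> c') (f2 : c' ~> shift a)
      (g : b ~> c) (g1 : c ~> a') (g2 : a' ~> shift b)
      (h1 : c ~> b') (h2 : b' ~> shift a),
    dist f f1 f2 -> dist g g1 g2 -> dist (g ∘ f) h1 h2 ->
    exists (u : c' ~> b') (v : b' ~> a'),
      [/\ dist u v (fmor shift f1 ∘ g2),
          u ∘ f1 = h1 ∘ g, v ∘ h1 = g1, h2 ∘ u = f2
        & g2 ∘ v = fmor shift f ∘ h2] }.

Arguments shift {_}.
Arguments dist {_ _ _ _}.

Definition is_exact (K L : triangulatedCategory) (F : functor K L) : Prop :=
  is_additive F /\
  exists eta : forall a : K, F (shift a) ~> shift (F a),
    @is_natural_iso K L (comp_functor F shift) (comp_functor shift F) eta /\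
    forall (a b c : K) (f : a ~> b) (g : b ~> c) (h : c ~> shift a),
      dist f g h -> dist (fmor F f) (fmor F g) (eta a ∘ fmor F h).

Record symMonoidal (C : category) := SymMonoidal {
  tens : C -> C -> C;
  tensm : forall a a' b b' : C,
    a ~> a' -> b ~> b' -> tens a b ~> tens a' b';
  tensm_id : forall a b, tensm (idm a) (idm b) = idm (tens a b);
  tensm_comp : forall (a a' a'' b b' b'' : C) (f' : a' ~> a'') (f : a ~> a')
      (g' : b' ~> b'') (g : b ~> b'),
    tensm (f' ∘ f) (g' ∘ g) = tensm f' g' ∘ tensm f g;
  tunit : C;
  assoc : forall a b c, tens (tens a b) c ~> tens a (tens b c);
  assoc_iso : forall a b c, is_iso (assoc a b c);
  assoc_nat : forall (a a' b b' c c' : C)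
      (f : a ~> a') (g : b ~> b') (h : c ~> c'),
    assoc a' b' c' ∘ tensm (tensm f g) h
      = tensm f (tensm g h) ∘ assoc a b c;
  lunit : forall a, tens tunit a ~> a;
  lunit_iso : forall a, is_iso (lunit a);
  lunit_nat : forall (a a' : C) (f : a ~> a'),
    lunit a' ∘ tensm (idm tunit) f = f ∘ lunit a;
  runit : forall a, tens a tunit ~> a;
  runit_iso : forall a, is_iso (runit a);
  runit_nat : forall (a a' : C) (f : a ~> a'),
    runit a' ∘ tensm f (idm tunit) = f ∘ runit a;
  braid : forall a b, tens a b ~> tens b a;
  braid_nat : forall (a a' b b' : C) (f : a ~> a') (g : b ~> b'),
    braid a' b' ∘ tensm f g = tensm g f ∘ braid a b;
  braid_sym : forall a b, braid b a ∘ braid a b = idm (tens a b);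
  pentagon : forall a b c d,
    assoc a b (tens c d) ∘ assoc (tens a b) c d
      = tensm (idm a) (assoc b c d) ∘ assoc a (tens b c) d
        ∘ tensm (assoc a b c) (idm d);
  triangle : forall a b,
    tensm (idm a) (lunit b) ∘ assoc a tunit b = tensm (runit a) (idm b);
  hexagon : forall a b c,
    assoc b c a ∘ braid a (tens b c) ∘ assoc a b c
      = tensm (idm b) (braid a c) ∘ assoc b a c
        ∘ tensm (braid a b) (idm c) }.

Program Definition tens_left (C : category) (M : symMonoidal C) (a : C) :
    functor C C :=
  @Functor C C (tens M a) (fun b c f => tensm M (idm a) f) _ _.
Next Obligation. by move=> C M a b; rewrite /= tensm_id. Qed.
Next Obligation.
by move=> C M a b c d g f; rewrite /= -tensm_comp compm_idl.
Qed.

Program Definition tens_right (C : category) (M : symMonoidal C) (a : C) :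
    functor C C :=
  @Functor C C (fun b => tens M b a) (fun b c f => tensm M f (idm a)) _ _.
Next Obligation. by move=> C M a b; rewrite /= tensm_id. Qed.
Next Obligation.
by move=> C M a b c d g f; rewrite /= -tensm_comp compm_idl.
Qed.

Record tensorTriangulatedCategory := TensorTriangulatedCategory {
  tt_tri :> triangulatedCategory;
  tt_mon : symMonoidal tt_tri;
  tt_exactl : forall a : tt_tri, is_exact (tens_left tt_mon a);
  tt_exactr : forall a : tt_tri, is_exact (tens_right tt_mon a) }.

Notation "a ⊗ b" := (tens (tt_mon _) a b) : cat_scope.
Notation "f ⊗₁ g" := (tensm (tt_mon _) f g) : cat_scope.

(* [tpow a n] is [a ⊗ (a ⊗ ( ... ⊗ a))] with [n] factors, so that
   [tpow a 1] is [a] on the nose; [tpow a 0] is the unit. *)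
Fixpoint tpow (K : tensorTriangulatedCategory) (a : K) (n : nat) : K :=
  match n with
  | 0 => tunit (tt_mon K)
  | n'.+1 => match n' with 0 => a | _.+1 => a ⊗ tpow a n' end
  end.

Fixpoint tpowm (K : tensorTriangulatedCategory) (a b : K) (f : a ~> b)
    (n : nat) : tpow a n ~> tpow b n :=
  match n return tpow a n ~> tpow b n with
  | 0 => idm (tunit (tt_mon K))
  | n'.+1 =>
      match n' return tpow a n' ~> tpow b n' ->
                      tpow a n'.+1 ~> tpow b n'.+1 with
      | 0 => fun _ => f
      | _.+1 => fun fn' => f ⊗₁ fn'
      end (tpowm f n')
  end.

Record thick_tensor_ideal (K : tensorTriangulatedCategory) (A : set K) :
    Prop := ThickTensorIdeal {
  ideal_zero : A (zero_obj K);
  ideal_tri : forall (a b c : K) (f : a ~> b) (g : b ~> c) (h : c ~> shift a),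
    dist f g h ->
    [/\ A a -> A b -> A c, A b -> A c -> A a & A a -> A c -> A b];
  ideal_thick : forall a b c : K, A a -> a ≅ b ⊕ c -> A b /\ A c;
  ideal_tens : forall a b : K, A a -> A (a ⊗ b) }.

Definition Spc (K : tensorTriangulatedCategory) : set (set K) :=
  [set P | [/\ thick_tensor_ideal P, P `<` setT
             & forall a b : K, P (a ⊗ b) -> P a \/ P b]].

Arguments Spc : clear implicits.

(* Morphisms of the localization [C[S^-1]] are formal composites of morphisms
   of [C] and of formal inverses of morphisms in [S], modulo the congruence
   generated by the category axioms, the functoriality of [C -> C[S^-1]] and
   the relations making the formal inverses two-sided inverses. *)
Section Localization.
Variables (C : category) (S : forall a b : C, set (a ~> b)).

Inductive loc_expr : C -> C -> Type :=
| LocMor a b of a ~> b : loc_expr a b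
| LocInv a b (s : a ~> b) of S s : loc_expr b a
| LocComp a b c of loc_expr b c & loc_expr a b : loc_expr a c.

Inductive loc_eq : forall a b, loc_expr a b -> loc_expr a b -> Prop :=
| loc_eq_refl a b (x : loc_expr a b) : loc_eq x x
| loc_eq_sym a b (x y : loc_expr a b) : loc_eq x y -> loc_eq y x
| loc_eq_trans a b (x y z : loc_expr a b) :
    loc_eq x y -> loc_eq y z -> loc_eq x z
| loc_eq_congr a b c (x x' : loc_expr b c) (y y' : loc_expr a b) :
    loc_eq x x' -> loc_eq y y' -> loc_eq (LocComp x y) (LocComp x' y')
| loc_eq_idl a b (x : loc_expr a b) : loc_eq (LocComp (LocMor (idm b)) x) x
| loc_eq_idr a b (x : loc_expr a b) : loc_eq (LocComp x (LocMor (idm a))) x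
| loc_eq_assoc a b c d (z : loc_expr c d) (y : loc_expr b c)
    (x : loc_expr a b) :
    loc_eq (LocComp z (LocComp y x)) (LocComp (LocComp z y) x)
| loc_eq_comp a b c (g : b ~> c) (f : a ~> b) :
    loc_eq (LocMor (g ∘ f)) (LocComp (LocMor g) (LocMor f))
| loc_eq_invl a b (s : a ~> b) (Ss : S s) :
    loc_eq (LocComp (LocInv Ss) (LocMor s)) (LocMor (idm a))
| loc_eq_invr a b (s : a ~> b) (Ss : S s) :
    loc_eq (LocComp (LocMor s) (LocInv Ss)) (LocMor (idm b)).

Definition loc_rel a b : rel {classic loc_expr a b} :=
  fun x y => `[< loc_eq x y >].

Lemma loc_rel_equiv a b : equiv_class_of (@loc_rel a b).
Proof.
split=> [x | x y | y x z].
- exact/asboolP/loc_eq_refl.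
- by apply/asboolP/asboolP; exact: loc_eq_sym.
- by move=> /asboolP xy /asboolP yz; apply/asboolP; exact: loc_eq_trans xy yz.
Qed.

Canonical loc_equiv a b := EquivRelPack (@loc_rel_equiv a b).

Definition loc_hom a b : Type := {eq_quot (loc_equiv a b)}%qT.

Definition loc_class a b (x : loc_expr a b) : loc_hom a b :=
  (\pi_{eq_quot (loc_equiv a b)} (x : {classic loc_expr a b}))%qT.

Definition loc_repr a b (u : loc_hom a b) : loc_expr a b :=
  repr (u : {eq_quot (loc_equiv a b)}%qT).

Lemma loc_reprK a b (u : loc_hom a b) : loc_class (loc_repr u) = u.
Proof. exact: reprK. Qed.

Lemma loc_classP a b (x y : loc_expr a b) :
  loc_class x = loc_class y <-> loc_eq x y.
Proof.
split=> [/eqmodP/asboolP // | xy].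
by apply/eqmodP/asboolP.
Qed.

Definition loc_comp a b c (v : loc_hom b c) (u : loc_hom a b) : loc_hom a c :=
  loc_class (LocComp (loc_repr v) (loc_repr u)).

Lemma loc_compE a b c (y : loc_expr b c) (x : loc_expr a b) :
  loc_comp (loc_class y) (loc_class x) = loc_class (LocComp y x).
Proof. by apply/loc_classP/loc_eq_congr; apply/loc_classP/loc_reprK. Qed.

Program Definition localization : category :=
  @Category C loc_hom (fun a => loc_class (LocMor (idm a))) loc_comp _ _ _.
Next Obligation.
move=> a b f; rewrite -(loc_reprK f) loc_compE.
exact/loc_classP/loc_eq_idl.
Qed.
Next Obligation.
move=> a b f; rewrite -(loc_reprK f) loc_compE.
exact/loc_classP/loc_eq_idr.
Qed.
Next Obligation.
move=> a b c d h g f; rewrite -(loc_reprK f) -(loc_reprK g) -(loc_reprK h).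
rewrite !loc_compE; exact/loc_classP/loc_eq_assoc.
Qed.

Program Definition loc_functor : functor C localization :=
  @Functor C localization id (fun a b f => loc_class (LocMor f)) _ _.
Next Obligation.
by move=> a b c g f; rewrite /= loc_compE; exact/loc_classP/loc_eq_comp.
Qed.

End Localization.

Section LocalizationZero.
Variables (A : additiveCategory) (S : forall a b : A, set (a ~> b)).
Local Notation Q := (loc_functor S).

Lemma compm_zerol (a b c : A) (f : a ~> b) : (0 : b ~> c) ∘ f = 0.
Proof. by apply: (addrI (0 ∘ f)); rewrite -[LHS]compm_addl !addr0. Qed.

Lemma compm_zeror (a b c : A) (g : b ~> c) : g ∘ (0 : a ~> b) = 0.
Proof. by apply: (addrI (g ∘ 0)); rewrite -[LHS]compm_addr !addr0. Qed.

Lemma zero_obj_idm : idm (zero_obj A) = 0.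
Proof.
have [[u [_ uP]] _] := zero_objP (zero_obj A).
by rewrite -(uP (idm _)) // -(uP 0).
Qed.

Lemma loc_zero_natl (a b c : A) (u : @hom (localization S) a b) :
  fmor Q (0 : b ~> c) ∘ u = fmor Q (0 : a ~> c).
Proof.
rewrite -(loc_reprK u); move: (loc_repr u) c => {u}.
elim=> {a b} [a b f | a b s Ss | a b d y IHy x IHx] c.
- by rewrite -[LHS](fmor_comp Q 0 f) compm_zerol.
- rewrite -(compm_zerol c s) fmor_comp -compmA.
  rewrite [X in _ ∘ X](_ : _ = idm (b : localization S)) ?compm_idr //.
  by rewrite /= loc_compE; exact/loc_classP/loc_eq_invr.
- by rewrite -loc_compE -[loc_comp _ _]/(@compm (localization S) _ _ _ _ _)
     compmA IHy IHx.
Qed.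

Lemma loc_zero_natr (a b c : A) (u : @hom (localization S) b c) :
  u ∘ fmor Q (0 : a ~> b) = fmor Q (0 : a ~> c).
Proof.
rewrite -(loc_reprK u); move: (loc_repr u) a => {u}.
elim=> {b c} [b c f | b c s Ss | b d c y IHy x IHx] a.
- by rewrite -[LHS](fmor_comp Q f 0) compm_zeror.
- rewrite -(compm_zeror a s) fmor_comp compmA.
  rewrite [X in X ∘ _](_ : _ = idm (b : localization S)) ?compm_idl //.
  by rewrite /= loc_compE; exact/loc_classP/loc_eq_invl.
- by rewrite -loc_compE -[loc_comp _ _]/(@compm (localization S) _ _ _ _ _)
     -compmA IHx IHy.
Qed.

Lemma loc_zero_obj : @is_zero_object (localization S) (zero_obj A).
Proof.
have idz : idm (zero_obj A : localization S) = fmor Q 0.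
  by rewrite -zero_obj_idm (fmor_id Q).
move=> a; split.
  exists (fmor Q (0 : (a : A) ~> _)); split=> // u _.
  by rewrite -[RHS]compm_idl idz loc_zero_natl.
exists (fmor Q (0 : _ ~> (a : A))); split=> // u _.
by rewrite -[RHS]compm_idr idz loc_zero_natr.
Qed.

Lemma loc_zero_morP (a b : A) (f : a ~> b) :
  is_zero_mor (fmor Q f) <-> fmor Q f = fmor Q 0.
Proof.
split=> [[z [g [h [zP ->]]]] | ->].
  have [[g' [_ gP]] _] := zP a; have [_ [h' [_ hP]]] := zP b.
  rewrite -(gP g) // (gP (fmor Q (0 : a ~> (z : A)))) //.
  by rewrite -(hP h) // (hP (fmor Q (0 : (z : A) ~> b))) // loc_zero_natl.
exists (zero_obj A), (fmor Q 0), (fmor Q 0); split; first exact: loc_zero_obj.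
by rewrite loc_zero_natl.
Qed.

End LocalizationZero.

Definition cone_in (K : triangulatedCategory) (A : set K) (a b : K) :
    set (a ~> b) :=
  [set s | exists (c : K) (g : b ~> c) (h : c ~> shift a), dist s g h /\ A c].

Definition verdier_quotient (K : triangulatedCategory) (A : set K) : category :=
  localization (@cone_in K A).

Definition verdier_functor (K : triangulatedCategory) (A : set K) :
    functor K (verdier_quotient A) :=
  loc_functor (@cone_in K A).

(* Main.v *)
Require Import Defs.
From mathcomp Require Import all_boot all_algebra.
From mathcomp Require Import boolp classical_sets.

Set Implicit Arguments.
Unset Strict Implicit.
Unset Printing Implicit Defensive.

Import GRing.Theory.

Local Open Scope classical_set_scope.
Local Open Scope ring_scope.
Local Open Scope cat_scope.

(** The powers of [f] detect a multiplicative family of objects: let [S] be the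
    set of all [c] such that some power of [f] factors through [c].  Tensoring
    two factorizations shows that [S] is closed under tensor products
    ([tpowm_add]), and [a] is in [S].  If [0] belongs to [S], then a power of
    [f] is zero.

    Otherwise some prime [P] avoids [S] ([exists_prime_avoiding]).  As in
    commutative algebra, it is a maximal element, given by Zorn's lemma, among
    the thick tensor ideals disjoint from [S].  Primality needs no description
    of generated ideals: the transporter of all [x] with [x ⊗ b] in [P] is
    itself a thick tensor ideal containing [P] ([transporter_ideal]), so by
    maximality it either equals [P] or meets [S].

    On the other hand, [f] vanishes in the Verdier quotient by [P], hence it
    factors through an object of [P] ([verdier_zero_factors]); this object lies
    in both [S] and [P], a contradiction.  Turning an equation in the quotient
    into one in the category takes a calculus of right fractions
    ([loc_eq_LocMor]), whose axioms hold for the morphisms with cone in [P]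
    because every morphism to an object of [P] is killed by such a morphism
    ([cone_in_kill]). *)

(** * Equality of morphisms in a localization with right fractions *)

Section RightFractions.
Variables (C : category) (S : forall a b : C, set (a ~> b)).
Hypothesis S_id : forall a : C, S (idm a).
Hypothesis S_comp : forall (a b c : C) (s : b ~> c) (t : a ~> b),
  S s -> S t -> S (s ∘ t).
Hypothesis S_ore : forall (a b w : C) (s : a ~> b) (h : w ~> b), S s ->
  exists (w' : C) (t : w' ~> w) (m : w' ~> a), S t /\ h ∘ t = s ∘ m.
Hypothesis S_cancel : forall (a b w : C) (s : a ~> b) (h k : w ~> a), S s ->
  s ∘ h = s ∘ k -> exists (w' : C) (t : w' ~> w), S t /\ h ∘ t = k ∘ t.

Let loc_expr := (@loc_expr C S).

(** Regard the morphisms of [S] as coverings.  An expression [e] of the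
    localization should act on generalized points [h : w ~> a] by composition;
    [transports e h k] means that [e ∘ h] and [k] agree after passing to a
    covering of [w].  Taking a relation instead of a function into roofs avoids
    choosing roofs and quotienting them: that it is a function, up to coverings,
    is a property, and it makes the relation an invariant of [loc_eq]. *)
Fixpoint transports a b (e : loc_expr a b) (w : C) : w ~> a -> w ~> b -> Prop :=
  match e in Defs.loc_expr _ a b return w ~> a -> w ~> b -> Prop with
  | LocMor _ _ f => fun h k =>
      exists (v : C) (t : v ~> w), S t /\ f ∘ h ∘ t = k ∘ t
  | LocInv _ _ s _ => fun h k =>
      exists (v : C) (t : v ~> w), S t /\ h ∘ t = s ∘ k ∘ t
  | LocComp _ m _ y x => fun h k =>
      exists (v : C) (t : v ~> w) (l : v ~> m),
        [/\ S t, transports x (h ∘ t) l & transports y l (k ∘ t)]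
  end.

Lemma transports_precomp a b (e : loc_expr a b) w v (u : v ~> w) h k :
  transports e h k -> transports e (h ∘ u) (k ∘ u).
Proof.
elim: e w v u h k => {a b} [a b f|a b s Ss|a b c y IHy x IHx] w v u h k /=.
- case=> [w' [t [St E]]]; have [v' [r [r' [Sr Er]]]] := S_ore u St.
  by exists v', r; split=> //; rewrite -!compmA Er !compmA E.
- case=> [w' [t [St E]]]; have [v' [r [r' [Sr Er]]]] := S_ore u St.
  by exists v', r; split=> //; rewrite -!compmA Er !compmA E.
- case=> [w' [t [l [St Hx Hy]]]]; have [v' [r [r' [Sr Er]]]] := S_ore u St.
  exists v', r, (l ∘ r'); split=> //.
    by rewrite -compmA Er compmA; exact: IHx.
  by rewrite -compmA Er compmA; exact: IHy.
Qed.

Lemma transports_local a b (e : loc_expr a b) w v (u : v ~> w) h k :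
  S u -> transports e (h ∘ u) (k ∘ u) -> transports e h k.
Proof.
case: e h k => {a b} [a b f|a b s Ss|a b c y x] h k Su /=.
- case=> [w' [t [St E]]]; exists w', (u ∘ t); split; first exact: S_comp.
  by move: E; rewrite !compmA.
- case=> [w' [t [St E]]]; exists w', (u ∘ t); split; first exact: S_comp.
  by move: E; rewrite !compmA.
- case=> [w' [t [l [St Hx Hy]]]]; exists w', (u ∘ t), l.
  by split; rewrite ?compmA //; exact: S_comp.
Qed.

Lemma transports_total a b (e : loc_expr a b) w (h : w ~> a) :
  exists (v : C) (t : v ~> w) k, S t /\ transports e (h ∘ t) k.
Proof.
elim: e w h => {a b} [a b f|a b s Ss|a b c y IHy x IHx] w h /=.
- exists w, (idm w), (f ∘ h); split=> //; exists w, (idm w).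
  by rewrite !compm_idr.
- have [v [t [m [St E]]]] := S_ore h Ss; exists v, t, m; split=> //.
  by exists v, (idm v); rewrite E.
- have [v [t [l [St Hx]]]] := IHx _ h.
  have [v' [t' [k [St' Hy]]]] := IHy _ l.
  exists v', (t ∘ t'), k; split; first exact: S_comp.
  exists v', (idm v'), (l ∘ t'); split=> //; rewrite !compm_idr //.
  by rewrite compmA; exact: transports_precomp.
Qed.

Lemma transports_fun a b (e : loc_expr a b) w (h : w ~> a) k k' :
  transports e h k -> transports e h k' ->
  exists (v : C) (t : v ~> w), S t /\ k ∘ t = k' ∘ t.
Proof.
elim: e w h k k' => {a b} [a b f|a b s Ss|a b c y IHy x IHx] w h k k' /=.
- case=> [v [t [St E]]] [v' [t' [St' E']]].
  have [u [r [r' [Sr Er]]]] := S_ore t St'.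
  exists u, (t ∘ r); split; first exact: S_comp.
  by rewrite compmA -E -compmA Er !compmA E'.
- case=> [v [t [St E]]] [v' [t' [St' E']]].
  have [u [r [r' [Sr Er]]]] := S_ore t St'.
  have [|q [p [Sp Ep]]] := @S_cancel _ _ _ s (k ∘ (t ∘ r)) (k' ∘ (t ∘ r)) Ss.
    by rewrite [LHS]compmA [s ∘ k ∘ _]compmA -E -compmA Er !compmA E'.
  exists q, (t ∘ r ∘ p); split; first by do !apply: S_comp.
  by rewrite !compmA in Ep *.
- case=> [v [t [l [St Hx Hy]]]] [v' [t' [l' [St' Hx' Hy']]]].
  have [u [r [r' [Sr Er]]]] := S_ore t St'.
  have [||q [p [Sp Ep]]] := IHx _ (h ∘ (t ∘ r)) (l ∘ r) (l' ∘ r').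
  + by rewrite compmA; exact: transports_precomp.
  + by rewrite Er compmA; exact: transports_precomp.
  have [||q' [p' [Sp' Ep']]] :=
      IHy _ (l ∘ r ∘ p) (k ∘ (t ∘ r) ∘ p) (k' ∘ (t ∘ r) ∘ p).
  + by rewrite compmA; do 2 apply: transports_precomp.
  + by rewrite Ep Er compmA; do 2 apply: transports_precomp.
  exists q', (t ∘ r ∘ p ∘ p'); split; first by do !apply: S_comp.
  by rewrite !compmA in Ep' *.
Qed.

(** Two total functions, one of which has its graph contained in that of the
    other, are equal.  It halves the verification of each relation that
    generates [loc_eq]. *)
Lemma transports_sub_eq a b (x y : loc_expr a b) :
  (forall w (h : w ~> a) k, transports x h k -> transports y h k) ->
  forall w (h : w ~> a) k, transports x h k <-> transports y h k.
Proof.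
move=> xy w h k; split; first exact: xy.
move=> Hy; have [v [t [m [St Hx]]]] := transports_total x h.
have [u [r [Sr E]]] := transports_fun (xy _ _ _ Hx) (transports_precomp t Hy).
apply: (transports_local (u := t ∘ r)); first exact: S_comp.
by rewrite !compmA -E; exact: transports_precomp.
Qed.

Lemma loc_eq_transports a b (x y : loc_expr a b) : loc_eq x y ->
  forall w (h : w ~> a) k, transports x h k <-> transports y h k.
Proof.
elim=> {a b x y} [a b x|a b x y _ IH|a b x y z _ IH1 _ IH2
  |a b c x x' y y' _ IH1 _ IH2|a b x|a b x|a b c d z y x|a b c g f
  |a b s Ss|a b s Ss] //.
- by move=> w h k; split=> /IH.
- by move=> w h k; split=> [/IH1/IH2|/IH2/IH1].
- by move=> w h k /=; split=> [] [v [t [l [St /IH2 Hx /IH1 Hy]]]];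
    exists v, t, l.
- move=> w h k; apply: iff_sym; apply: transports_sub_eq => {}w {}h {}k H.
  exists w, (idm w), k; rewrite !compm_idr; split=> //.
  by exists w, (idm w); rewrite !compm_idr compm_idl.
- move=> w h k; apply: iff_sym; apply: transports_sub_eq => {}w {}h {}k H.
  exists w, (idm w), h; rewrite !compm_idr; split=> //.
  by exists w, (idm w); rewrite !compm_idr compm_idl.
- apply: transports_sub_eq => w h k.
  case=> [v [t [m [St [v' [t' [l [St' Hx Hy]]]] Hz]]]].
  exists v', (t ∘ t'), l; split; first exact: S_comp.
    by rewrite compmA.
  exists v', (idm v'), (m ∘ t'); rewrite !compm_idr; split=> //.
  by rewrite compmA; exact: transports_precomp.
- apply: transports_sub_eq => w h k [v [t [St E]]].
  exists v, t, (f ∘ h ∘ t); split=> //; exists v, (idm v); rewrite !compm_idr.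
    by rewrite compmA.
  by rewrite -E !compmA.
- move=> w h k; apply: iff_sym; apply: transports_sub_eq => {}w {}h {}k.
  case=> [v [t [St]]]; rewrite compm_idl => E.
  exists v, t, (s ∘ h ∘ t); split=> //; exists v, (idm v); rewrite !compm_idr.
    by rewrite compmA.
  by rewrite -compmA E.
- move=> w h k; apply: iff_sym; apply: transports_sub_eq => {}w {}h {}k.
  case=> [v [t [St]]]; rewrite compm_idl => E.
  have [v' [t' [m [St' E']]]] := S_ore (h ∘ t) Ss.
  exists v', (t ∘ t'), m; split; first exact: S_comp.
    by exists v', (idm v'); rewrite !compm_idr compmA.
  by exists v', (idm v'); rewrite !compm_idr -E' E compmA.
Qed.

(** The generalized point to evaluate at is [idm a]: the expression of [f] sends
    it to [f], hence so does that of [g], which says that [f] and [g] agree on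
    a covering of [a]. *)
Lemma loc_eq_LocMor a b (f g : a ~> b) :
  loc_eq (LocMor S f) (LocMor S g) ->
  exists (w : C) (s : w ~> a), S s /\ f ∘ s = g ∘ s.
Proof.
move=> /loc_eq_transports/(_ _ (idm a) f)[+ _].
case; first by exists a, (idm a); rewrite !compm_idr.
by move=> w [s [Ss]]; rewrite compm_idr => E; exists w, s.
Qed.

End RightFractions.

(** * Isomorphisms, equivalences and additive functors *)

Lemma iso_idm (C : category) (a : C) : is_iso (idm a).
Proof. by exists (idm a); rewrite compm_idl. Qed.

Lemma isomorphic_sym (C : category) (a b : C) : a ≅ b -> b ≅ a.
Proof. by case=> f [g [gf fg]]; exists g, f. Qed.

Lemma isomorphic_trans (C : category) (a b c : C) : a ≅ b -> b ≅ c -> a ≅ c.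
Proof.
case=> f [f' [ff ff']] [g [g' [gg gg']]]; exists (g ∘ f), (f' ∘ g'); split.
  by rewrite compmA -(compmA f') gg compm_idr.
by rewrite compmA -(compmA g) ff' compm_idr.
Qed.

Lemma iso_cancel_r (C : category) (x y z : C) (u : x ~> y) (f g : y ~> z) :
  is_iso u -> f ∘ u = g ∘ u -> f = g.
Proof.
by case=> v [_ uv] E; rewrite -[f]compm_idr -[g]compm_idr -uv !compmA E.
Qed.

Lemma iso_cancel_l (C : category) (x y z : C) (u : y ~> z) (f g : x ~> y) :
  is_iso u -> u ∘ f = u ∘ g -> f = g.
Proof.
by case=> v [vu _] E; rewrite -[f]compm_idl -[g]compm_idl -vu -!compmA E.
Qed.

Lemma naturally_iso_id_faithful (C : category) (H : functor C C) :
  naturally_iso H (id_functor C) ->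
  forall (x y : C) (f g : x ~> y), fmor H f = fmor H g -> f = g.
Proof.
case=> eta [eta_iso nat] x y f g E; apply: (iso_cancel_r (eta_iso x)).
by have := nat _ _ f; have := nat _ _ g; rewrite E /= => -> ->.
Qed.

Lemma equivalence_faithful (C D : category) (F : functor C D) :
  is_equivalence F ->
  forall (a b : C) (f g : a ~> b), fmor F f = fmor F g -> f = g.
Proof.
case=> G [GF _] a b f g E; apply: (naturally_iso_id_faithful GF).
by rewrite /= E.
Qed.

(** The candidate preimage is the conjugate of [fmor G g] by the natural
    isomorphism.  It is checked after applying [G], which is faithful because
    [comp_functor F G] is isomorphic to the identity. *)
Lemma equivalence_full (C D : category) (F : functor C D) :
  is_equivalence F ->
  forall (a b : C) (g : F a ~> F b), exists f, fmor F f = g.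
Proof.
case=> G [[eta [eta_iso nat]] FG] a b g; have [i [ieta etai]] := eta_iso a.
exists (eta b ∘ fmor G g ∘ i).
have Gfaithful (x y : D) (p q : x ~> y) : fmor G p = fmor G q -> p = q.
  by move=> E; apply: (naturally_iso_id_faithful FG); rewrite /= E.
apply: Gfaithful; apply: (iso_cancel_l (eta_iso b)).
by have /= -> := nat _ _ (eta b ∘ fmor G g ∘ i); rewrite -compmA ieta compm_idr.
Qed.

Lemma equivalence_ess_surj (C D : category) (F : functor C D) :
  is_equivalence F -> forall d : D, exists a, F a ≅ d.
Proof.
case=> G [_ [eta [eta_iso _]]] d; exists (G d), (eta d); exact: eta_iso.
Qed.

Section Additive.
Variable A : additiveCategory.
Implicit Types a b c : A.

Lemma compmDl a b c (g g' : b ~> c) (f : a ~> b) :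
  (g + g') ∘ f = g ∘ f + g' ∘ f.
Proof. exact: compm_addl. Qed.

Lemma compmDr a b c (g : b ~> c) (f f' : a ~> b) :
  g ∘ (f + f') = g ∘ f + g ∘ f'.
Proof. exact: compm_addr. Qed.

Lemma compmNl a b c (g : b ~> c) (f : a ~> b) : (- g) ∘ f = - (g ∘ f).
Proof. by apply/eqP; rewrite -addr_eq0 -compmDl addNr compm_zerol. Qed.

Lemma compmNr a b c (g : b ~> c) (f : a ~> b) : g ∘ (- f) = - (g ∘ f).
Proof. by apply/eqP; rewrite -addr_eq0 -compmDr addNr compm_zeror. Qed.

Lemma compmBl a b c (g g' : b ~> c) (f : a ~> b) :
  (g - g') ∘ f = g ∘ f - g' ∘ f.
Proof. by rewrite compmDl compmNl. Qed.

Lemma compmBr a b c (g : b ~> c) (f f' : a ~> b) :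
  g ∘ (f - f') = g ∘ f - g ∘ f'.
Proof. by rewrite compmDr compmNr. Qed.

End Additive.

Section AdditiveFunctors.
Variable A : additiveCategory.

Lemma is_additive0 (B : additiveCategory) (F : functor A B) :
  is_additive F -> forall a b : A, fmor F (0 : a ~> b) = 0.
Proof. by move=> Fadd a b; apply: (addrI (fmor F 0)); rewrite -Fadd !addr0. Qed.

Lemma is_additiveN (B : additiveCategory) (F : functor A B) :
  is_additive F -> forall (a b : A) (f : a ~> b), fmor F (- f) = - fmor F f.
Proof.
move=> Fadd a b f; apply/eqP.
by rewrite -addr_eq0 -Fadd addNr is_additive0.
Qed.

Lemma fobj_isomorphic_dsum (B : additiveCategory) (F : functor A B) :
  is_additive F -> forall a b c : A, a ≅ b ⊕ c -> F a ≅ F b ⊕ F c.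
Proof.
move=> Fadd a b c [u [v [vu uv]]].
pose g := inj1 (F b) (F c) ∘ fmor F (prj1 b c) + inj2 _ _ ∘ fmor F (prj2 b c).
pose g' := fmor F (inj1 b c) ∘ prj1 (F b) (F c) + fmor F (inj2 b c) ∘ prj2 _ _.
have [g'g gg'] : g' ∘ g = idm _ /\ g ∘ g' = idm _.
  rewrite /g /g'; split.
    rewrite compmDl !compmDr !compmA.
    rewrite -!(compmA _ (prj1 _ _)) -!(compmA _ (prj2 _ _)).
    rewrite prj1_inj1 prj2_inj2 prj1_inj2 prj2_inj1.
    rewrite !compm_zeror !compm_zerol addr0 add0r !compm_idr.
    by rewrite -!fmor_comp -Fadd inj_prj fmor_id.
  rewrite compmDl !compmDr !compmA -!(compmA _ _ (fmor F _)) -!fmor_comp.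
  rewrite prj1_inj1 prj2_inj2 prj1_inj2 prj2_inj1.
  rewrite !is_additive0 // !compm_zeror !compm_zerol addr0 add0r.
  by rewrite !fmor_id !compm_idr inj_prj.
apply: (@isomorphic_trans _ _ (F (b ⊕ c))); last by exists g, g'.
by exists (fmor F u), (fmor F v); rewrite -!fmor_comp vu uv !fmor_id.
Qed.

End AdditiveFunctors.

(** * Exactness and fibers in triangulated categories *)

Section Triangulated.
Variable K : triangulatedCategory.
Implicit Types a b c x : K.

Let T := @shift K.

Lemma dist_comp0 a b c (f : a ~> b) (g : b ~> c) (h : c ~> T a) :
  dist f g h -> g ∘ f = 0.
Proof.
move=> D; have [w [E _]] :=
  dist_mor (u := idm a) (v := f) (dist_id a) D erefl.
by rewrite -E compm_zeror.
Qed.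

(** The axiom on morphisms of triangles fills in a third map only, so the
    triangles on [idm x] and on [f] are rotated first; what comes out is a map
    between shifts, which is then desuspended because [shift] is fully
    faithful. *)
Lemma dist_lift a b c x (f : a ~> b) (g : b ~> c) (h : c ~> T a) (k : x ~> b) :
  dist f g h -> g ∘ k = 0 -> exists m, k = f ∘ m.
Proof.
move=> /dist_rotate D gk; have /dist_rotate D0 := dist_id x.
have [|w [_]] := dist_mor (u := k) (v := 0) D0 D.
  by rewrite gk compm_zeror.
have [m <-] := equivalence_full (shift_equiv K) w.
rewrite fmor_id compmNr compmNl compm_idr -fmor_comp => /oppr_inj E.
by exists m; exact: (equivalence_faithful (shift_equiv K) E).
Qed.

Lemma dist_0id x :
  dist (0 : zero_obj K ~> x) (idm x) (0 : x ~> T (zero_obj K)).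
Proof.
apply/dist_rotate; apply: (dist_iso (u := idm x) (v := idm x) (w := 0)) (dist_id x).
- exact: iso_idm.
- exact: iso_idm.
- exists 0; rewrite !compm_zeror zero_obj_idm; split=> //.
  rewrite -(fmor_id T) zero_obj_idm is_additive0 //; exact: shift_additive.
- by [].
- by rewrite compm_zeror compm_zerol.
- rewrite is_additive0 ?oppr0 ?compm_zerol ?compm_zeror //.
  exact: shift_additive.
Qed.

(** [k] and the zero map are part of a morphism into the triangle on
    [0 ~> x]; its third component is the extension. *)
Lemma dist_extend a b c x (f : a ~> b) (g : b ~> c) (h : c ~> T a) (k : b ~> x) :
  dist f g h -> k ∘ f = 0 -> exists m, k = m ∘ g.
Proof.
move=> D kf.
have [|m [E _]] := dist_mor (u := 0) (v := k) D (dist_0id x).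
  by rewrite kf compm_zerol.
by exists m; rewrite E compm_idl.
Qed.

(** Rotating backwards needs the third object to be a shift, which holds up to
    isomorphism since [shift] is essentially surjective. *)
Lemma dist_unrotate b c d (g : b ~> c) (u : c ~> d) (v : d ~> T b) :
  dist g u v ->
  exists a (f : a ~> b) (h : c ~> T a), dist f g h /\ T a ≅ d.
Proof.
move=> D; have [a [i [j [ji ij]]]] := equivalence_ess_surj (shift_equiv K) d.
have [f Ef] := equivalence_full (shift_equiv K) (v ∘ i).
exists a, (- f), (j ∘ u); split; last by exists i, j.
apply/dist_rotate.
rewrite is_additiveN ?opprK ?Ef; last exact: shift_additive.
apply: (dist_iso (u := idm b) (v := idm c) (w := j)) D.
- exact: iso_idm.
- exact: iso_idm.
- by exists i.
- by rewrite compm_idl compm_idr.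
- by rewrite compm_idr.
- by rewrite fmor_id compm_idl -compmA ij compm_idr.
Qed.

Lemma dist_fiber b c (g : b ~> c) :
  exists a (f : a ~> b) (h : c ~> T a), dist f g h.
Proof.
have [d [u [v D]]] := dist_complete g.
by have [a [f [h [Df _]]]] := dist_unrotate D; exists a, f, h.
Qed.

End Triangulated.

(** * Morphisms that vanish in a Verdier quotient *)

Section VerdierQuotient.
Variables (K : triangulatedCategory) (N : set K).
Hypothesis N_zero : N (zero_obj K).
Hypothesis N_tri : forall (a b c : K) (f : a ~> b) (g : b ~> c)
  (h : c ~> shift a), dist f g h ->
  [/\ N a -> N b -> N c, N b -> N c -> N a & N a -> N c -> N b].

Let S := @cone_in K N.

Lemma two_of_three_iso (a b : K) : a ≅ b -> N a -> N b.
Proof.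
case=> u [v [vu uv]] Na.
have D : dist u (0 : b ~> zero_obj K) (0 : zero_obj K ~> shift a).
  apply: (dist_iso (u := idm a) (v := u) (w := idm _)) (dist_id a).
  - exact: iso_idm.
  - by exists v.
  - exact: iso_idm.
  - by [].
  - by rewrite !compm_zeror compm_zerol.
  - by rewrite compm_zeror compm_zerol.
by have [_ _] := N_tri D; exact.
Qed.

Lemma two_of_three_unshift (a : K) : N (shift a) -> N a.
Proof.
move=> Na; have /dist_rotate/N_tri[_ + _] := dist_id a.
exact.
Qed.

Lemma cone_in_id (a : K) : S (idm a).
Proof. by exists (zero_obj K), 0, 0; split=> //; exact: dist_id. Qed.

(** By the octahedron, the cone of a composite is an extension of the cones. *)
Lemma cone_in_comp (a b c : K) (s : b ~> c) (t : a ~> b) :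
  S s -> S t -> S (s ∘ t).
Proof.
move=> [x [s1 [s2 [Ds Nx]]]] [y [t1 [t2 [Dt Ny]]]].
have [z [r1 [r2 Dr]]] := dist_complete (s ∘ t).
have [u [v [/N_tri[_ _ Nz] _ _ _ _]]] := dist_octahedron Dt Ds Dr.
by exists z, r1, r2; split=> //; exact: Nz.
Qed.

(** The fiber of [h] does it: its cone is [c]. *)
Lemma cone_in_kill (w c : K) (h : w ~> c) : N c ->
  exists (v : K) (t : v ~> w), S t /\ h ∘ t = 0.
Proof.
move=> Nc; have [v [t [d D]]] := dist_fiber h.
by exists v, t; split; [exists c, h, d | exact: dist_comp0 D].
Qed.

(** [h] lifts along [s] if and only if its composite with the map to the cone of
    [s] vanishes, and that composite can be killed. *)
Lemma cone_in_ore (a b w : K) (s : a ~> b) (h : w ~> b) : S s ->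
  exists (v : K) (t : v ~> w) (m : v ~> a), S t /\ h ∘ t = s ∘ m.
Proof.
case=> c [g [d [D Nc]]].
have [v [t [St ght]]] := cone_in_kill (g ∘ h) Nc.
have [|m E] := dist_lift (k := h ∘ t) D; first by rewrite compmA.
by exists v, t, m.
Qed.

(** [h - k] factors through the fiber of [s], which lies in [N] since its shift
    is the cone, so this factor can be killed. *)
Lemma cone_in_cancel (a b w : K) (s : a ~> b) (h k : w ~> a) : S s ->
  s ∘ h = s ∘ k -> exists (v : K) (t : v ~> w), S t /\ h ∘ t = k ∘ t.
Proof.
case=> c [g [d [D Nc]]] E.
have [x [p [q [Dp Tx]]]] := dist_unrotate D.
have Nx : N x.
  apply: two_of_three_unshift; apply: two_of_three_iso Nc.
  exact: isomorphic_sym.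
have [|m Em] := dist_lift (k := h - k) Dp.
  by rewrite compmBr E subrr.
have [v [t [St mt]]] := cone_in_kill m Nx.
exists v, t; split=> //; apply/eqP.
by rewrite -subr_eq0 -compmBl Em -compmA mt compm_zeror.
Qed.

(** [f] vanishes in the quotient when it is killed by some [s] with cone in [N],
    and then it extends along the map from [a] to that cone. *)
Lemma verdier_zero_factors (a b : K) (f : a ~> b) :
  is_zero_mor (fmor (verdier_functor N) f) ->
  exists (c : K) (g : a ~> c) (h : c ~> b), N c /\ f = h ∘ g.
Proof.
move=> /loc_zero_morP/loc_classP/loc_eq_LocMor.
case=> [||||w [s [[c [g [d [D Nc]]]] fs]]].
- exact: cone_in_id.
- exact: cone_in_comp.
- exact: cone_in_ore.
- exact: cone_in_cancel.
have [|m E] := dist_extend (k := f) D; first by rewrite fs compm_zerol.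
by exists c, g, m.
Qed.

End VerdierQuotient.

(** * Thick tensor ideals and primes avoiding a multiplicative family *)

Section ThickIdeals.
Variable K : tensorTriangulatedCategory.
Implicit Types (a b c : K) (A : set K).
Let M := tt_mon K.

Lemma isomorphic_tens a a' b b' : a ≅ a' -> b ≅ b' -> a ⊗ b ≅ a' ⊗ b'.
Proof.
case=> f [f' [ff ff']] [g [g' [gg gg']]]; exists (f ⊗₁ g), (f' ⊗₁ g').
by rewrite -!tensm_comp ff ff' gg gg' !tensm_id.
Qed.

Lemma tens0m a a' b b' (g : b ~> b') : (0 : a ~> a') ⊗₁ g = 0.
Proof.
have [Tadd _] := tt_exactr b'.
rewrite -[0 in LHS](compm_zerol a' (idm a)) -[g]compm_idl tensm_comp.
by have /= -> := is_additive0 Tadd a a'; rewrite compm_zerol.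
Qed.

Lemma isomorphic_tensA a b c : (a ⊗ b) ⊗ c ≅ a ⊗ (b ⊗ c).
Proof. by exists (assoc M a b c); exact: assoc_iso. Qed.

Lemma isomorphic_tensC a b : a ⊗ b ≅ b ⊗ a.
Proof. by exists (braid M a b), (braid M b a); rewrite !braid_sym. Qed.

Lemma isomorphic_tensAC a b c : (a ⊗ b) ⊗ c ≅ (a ⊗ c) ⊗ b.
Proof.
apply: (isomorphic_trans (isomorphic_tensA a b c)).
apply: (isomorphic_trans _ (isomorphic_sym (isomorphic_tensA a c b))).
apply: isomorphic_tens (isomorphic_tensC b c).
by exists (idm a); exact: iso_idm.
Qed.

Lemma ideal_iso A a b : thick_tensor_ideal A -> a ≅ b -> A a -> A b.
Proof.
by move=> IA; apply: two_of_three_iso; [exact: ideal_zero | exact: ideal_tri].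
Qed.

(** The analogue of the ideal quotient [(A : b)] of a commutative ring. *)
Definition transporter A b : set K := [set x | A (x ⊗ b)].

Lemma transporter_ideal A b :
  thick_tensor_ideal A -> thick_tensor_ideal (transporter A b).
Proof.
move=> IA; have [Tadd [eta [_ Tdist]]] := tt_exactr b; split.
- exact: ideal_tens (ideal_zero IA).
- by move=> x y z f g h /Tdist; exact: ideal_tri IA _ _ _ _ _ _.
- move=> x y z Ax xyz; apply: (ideal_thick IA Ax).
  exact: (fobj_isomorphic_dsum Tadd xyz).
- move=> x y Ax; apply: (ideal_iso IA (isomorphic_tensAC x b y)).
  exact: ideal_tens.
Qed.

Lemma sub_transporter A b : thick_tensor_ideal A -> A `<=` transporter A b.
Proof. by move=> IA x Ax; exact: ideal_tens. Qed.

(** This smallest thick tensor ideal shows that some ideal is disjoint from [S]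
    as soon as [S] contains no zero object. *)
Lemma zero_objects_ideal : thick_tensor_ideal [set a : K | idm a = 0].
Proof.
have Zsh a : idm (shift a) = 0 <-> idm a = 0.
  rewrite -(fmor_id (@shift K)) -(is_additive0 (@shift_additive K)).
  by split=> [|-> //]; exact: equivalence_faithful (shift_equiv K) _ _ _ _.
have mid a b c (f : a ~> b) (g : b ~> c) (h : c ~> shift a) :
    dist f g h -> idm a = 0 -> idm c = 0 -> idm b = 0.
  move=> D a0 c0; have [|m ->] := dist_lift (k := idm b) D.
    by rewrite compm_idr -[g]compm_idl c0 compm_zerol.
  by rewrite -[f]compm_idr a0 compm_zeror compm_zerol.
split=> /=.
- exact: zero_obj_idm.
- move=> a b c f g h D; split; last exact: mid D.
    move=> a0 b0; move/dist_rotate in D; apply: mid D _ _ => //; exact/Zsh.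
  move=> b0 c0; do 2 move/dist_rotate in D; apply/Zsh; apply: mid D _ _ => //.
  exact/Zsh.
- move=> a b c a0 [u [v [_ uv]]].
  have bc0 : idm (b ⊕ c) = 0.
    by rewrite -uv -[u]compm_idr a0 compm_zeror compm_zerol.
  split; [rewrite -(prj1_inj1 b c) | rewrite -(prj2_inj2 b c)].
    by rewrite -[inj1 b c]compm_idl bc0 compm_zerol compm_zeror.
  by rewrite -[inj2 b c]compm_idl bc0 compm_zerol compm_zeror.
- by move=> a b a0; rewrite -tensm_id a0 tens0m.
Qed.

(** A maximal element [P] among the ideals disjoint from [S] is prime: if
    [a ⊗ b] is in [P] but [a] is not, the transporter of [b] is strictly larger
    than [P], so [P] contains [s ⊗ b] for some [s] in [S]; if [b] is not in [P]
    either, the same argument replaces [b] by some [t] in [S], and [t ⊗ s] is a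
    common element of [P] and [S]. *)
Lemma exists_prime_avoiding (S : set K) :
  S !=set0 -> (forall z, idm z = 0 -> ~ S z) ->
  (forall a b, S a -> S b -> S (a ⊗ b)) ->
  exists P, Spc K P /\ forall a, S a -> ~ P a.
Proof.
move=> [s0 Ss0] S0 Smul.
pose good A := thick_tensor_ideal A /\ forall a, S a -> ~ A a.
(* [set0] is admitted because it is the union of the empty chain. *)
have [F chain tot|P [PP Pmax]] :=
    @Zorn_bigcup _ (fun A => A = set0 \/ good A).
  have [noneg|/existsNP[B /not_implyP[FB B0]]] :=
      pselect (forall A, F A -> A = set0).
    by left; apply: bigcup0.
  right.
  have goodF A x : F A -> A x -> good A.
    by move=> FA Ax; case: (chain _ FA) => // A0; rewrite A0 in Ax.
  have [IB _] : good B by case: (chain _ FB).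
  have two x y : (\bigcup_(X in F) X) x -> (\bigcup_(X in F) X) y ->
      exists A, [/\ good A, F A, A x & A y].
    move=> [A FA Ax] [A' FA' Ay]; have [AA|AA] := tot _ _ FA FA'.
      by exists A'; split=> //; [exact: goodF Ay | exact: AA].
    by exists A; split=> //; [exact: goodF Ax | exact: AA].
  split; last first.
    by move=> a Sa [A FA Aa]; have [_ /(_ a Sa)] := goodF _ _ FA Aa.
  split.
  - by exists B => //; exact: ideal_zero.
  - move=> a b c f g h D; split=> x y; have [A [[IA _] FA Ax Ay]] := two _ _ x y;
      have [? ? ?] := ideal_tri IA D; exists A => //; auto.
  - move=> a b c [A FA Aa] abc; have [IA _] := goodF _ _ FA Aa.
    by have [Ab Ac] := ideal_thick IA Aa abc; split; exists A.
  - move=> a b [A FA Aa]; have [IA _] := goodF _ _ FA Aa.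
    by exists A => //; exact: ideal_tens.
have [IP dP] : good P.
  case: PP => // P0; case: (Pmax [set a : K | idm a = 0]).
    by rewrite P0; split=> [x []|/(_ _ (zero_obj_idm K))].
  by right; split; [exact: zero_objects_ideal | move=> a Sa /S0].
have meets b x : P (x ⊗ b) -> ~ P x -> exists2 s, S s & P (s ⊗ b).
  move=> Pxb nPx; apply: contrapT => H; apply: (Pmax (transporter P b)).
    split; first exact: sub_transporter.
    by move=> /(_ x Pxb).
  right; split; first exact: transporter_ideal.
  by move=> s Ss Ps; apply: H; exists s.
have tensC a b : P (a ⊗ b) -> P (b ⊗ a).
  exact: (ideal_iso IP (isomorphic_tensC a b)).
exists P; split=> //; split=> //.
  by split=> // /(_ s0 I); exact: dP.
move=> a b Pab; apply: contrapT => /not_orP[nPa nPb].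
have [s Ss /tensC Pbs] := meets _ _ Pab nPa.
have [t St Pts] := meets _ _ Pbs nPb.
by apply: dP Pts; exact: Smul.
Qed.

(** Powers are bracketed to the right, so a product of two powers is rebracketed
    by [u] and [v].  The base case [n = 0] is literal because [tpow a 1] is
    [a]; starting the induction there avoids the unit constraints. *)
Lemma tpowm_add a b (f : a ~> b) n m :
  exists (u : tpow a (n.+1 + m.+1) ~> tpow a n.+1 ⊗ tpow a m.+1)
         (v : tpow b n.+1 ⊗ tpow b m.+1 ~> tpow b (n.+1 + m.+1)),
  tpowm f (n.+1 + m.+1) = v ∘ (tpowm f n.+1 ⊗₁ tpowm f m.+1) ∘ u.
Proof.
elim: n => [|n [u [v IH]]].
  by exists (idm _), (idm _); rewrite compm_idl compm_idr.
have [i' [_ ij']] := assoc_iso M a (tpow a n.+1) (tpow a m.+1).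
exists (i' ∘ (idm a ⊗₁ u)), ((idm b ⊗₁ v) ∘ assoc M _ _ _).
rewrite -[LHS]/(f ⊗₁ tpowm f (n.+1 + m.+1)) IH.
rewrite -[X in X ⊗₁ _](compm_idr f) -[X in (X ∘ _) ⊗₁ _](compm_idl f).
rewrite !tensm_comp -[RHS]compmA -(compmA _ (assoc M _ _ _)) .
rewrite (compmA (assoc M _ _ _)) assoc_nat.
by rewrite -!compmA (compmA (assoc M _ _ _)) ij' compm_idl.
Qed.

End ThickIdeals.

(** * Nilpotence *)

Theorem proposition2p21 (K : tensorTriangulatedCategory) (a b : K)
    (f : a ~> b)
    (hf : forall P : set K, Spc K P -> is_zero_mor (fmor (verdier_functor P) f)) :
  exists n : nat, (1 <= n)%N /\ tpowm f n = 0.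
Proof.
pose S := [set c : K | exists n (g : tpow a n.+1 ~> c) (h : c ~> tpow b n.+1),
  tpowm f n.+1 = h ∘ g].
apply: contrapT => nil.
have [|z z0 [n [g [h E]]]|c d [n [g [h E]]] [m [g' [h' E']]]|P [PP dP]] :=
   @exists_prime_avoiding K S.
- by exists a, 0%N, (idm a), f; rewrite compm_idr.
- apply: nil; exists n.+1; split=> //; rewrite E.
  by rewrite -[g]compm_idl z0 compm_zerol compm_zeror.
- have [u [v Euv]] := tpowm_add f n m.
  exists (n + m.+1)%N, ((g ⊗₁ g') ∘ u), (v ∘ (h ⊗₁ h')).
  by rewrite [LHS]Euv E E' tensm_comp !compmA.
- have [IP _ _] := PP.
  have [c [g [h [Pc E]]]] :=
    verdier_zero_factors (ideal_zero IP) (@ideal_tri _ _ IP) (hf P PP).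
  by apply: dP Pc; exists 0%N, g, h.
Qed.
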